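(* Let $G$ be a compact Hausdorff topological group, let $X$ be a metrizable $G$-space and let $A$ be an invariant subset of $X$. Then $A$ is $G$-homotopy dense in $X$ if and only if the inclusion map $i:A\hookrightarrow X$ is a fine $G$-homotopy equivalence.
   Context: $G$ is a compact Hausdorff topological group. All spaces are completely regular and Hausdorff, and all maps are continuous. A $G$-space is a space with a continuous action of $G$; a $G$-map is a continuous map $f$ with $f(gx)=gf(x)$ for all $g\in G$ and all $x$. A subset $S$ of a $G$-space is invariant if $gs\in S$ for all $g\in G$, $s\in S$. A metrizable $G$-space is a $G$-space whose underlying space is metrizable. $G$-homotopy: with $I=[0,1]$, a $G$-homotopy is a continuous map $F:X\times I\to Y$ that is a $G$-map for the action $g(x,t)=(gx,t)$ on $X\times I$; write $F_t(x)=F(x,t)$. Given an open cover $\mathcal{U}$ of $Y$, a $G$-$\mathcal{U}$-homotopy is a $G$-homotopy $F:X\times I\to Y$ such that for every $x\in X$ there is $U\in\mathcal{U}$ with $F_t(x)\in U$ for all $t\in I$; then $F_0$ and $F_1$ are called $G$-$\mathcal{U}$-homotopic. $G$-homotopy dense: an invariant subset $A$ of a $G$-space $X$ is $G$-homotopy dense in $X$ if there exists a $G$-homotopy $F:X\times I\to X$ with $F_0=\mathrm{id}_X$ and $F_t(X)\subset A$ for every $t\in(0,1]$. For a map $f:X\to Y$ and an open cover $\mathcal{U}$ of $Y$, $f^{-1}(\mathcal{U})=\{f^{-1}(U)\mid U\in\mathcal{U}\}$, an open cover of $X$. A $G$-map $f:X\to Y$ is a fine $G$-homotopy equivalence if for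 every open cover $\mathcal{U}$ of $Y$ there is a $G$-map $\varphi:Y\to X$ such that $\varphi f$ is $G$-$f^{-1}(\mathcal{U})$-homotopic to $\mathrm{id}_X$ and $f\varphi$ is $G$-$\mathcal{U}$-homotopic to $\mathrm{id}_Y$. *)

(* Defs.v *)
From HB Require Import structures.
From mathcomp Require Import all_boot all_order all_algebra.
From mathcomp Require Import all_classical all_reals topology.
Set Implicit Arguments.
Unset Strict Implicit.
Unset Printing Implicit Defensive.
Import Order.TTheory GRing.Theory Num.Theory.
Import numFieldTopology.Exports.
Local Open Scope classical_set_scope.
Local Open Scope ring_scope.

HB.mixin Record isTopologicalGroup G of Topological G & Group G := {
  mulg_continuous : continuous (fun p : G * G => (p.1 * p.2)%g) ;
  invg_continuous : continuous (fun x : G => (x^-1)%g)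
}.

#[short(type="topologicalGroupType")]
HB.structure Definition TopologicalGroup :=
  {G of Topological G & Group G & isTopologicalGroup G}.

(* A G-space is a topological space together with a term of this type. *)
Record gaction (G : topologicalGroupType) (X : topologicalType) := GAction {
  gact :> G -> X -> X ;
  gact1 : forall x, gact 1%g x = x ;
  gactM : forall g h x, gact (g * h)%g x = gact g (gact h x) ;
  gact_continuous : continuous (fun p : G * X => gact p.1 p.2)
}.

Definition metrizable (R : realType) (X : topologicalType) : Prop :=
  exists d : X -> X -> R,
    [/\ forall x y, d x y = 0 <-> x = y,
        forall x y, d x y = d y x,
        forall x y z, d x z <= d x y + d y z &
        forall x : X, nbhs x = nbhs_ball_ (fun x e => [set y | d x y < e]) x].

Definition unit_interval (R : realType) : topologicalType :=
  set_type `[(0 : R), 1]%classic.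

Fact zero_in_unit_interval (R : realType) : (0 : R) \in `[(0 : R), 1]%classic.
Proof. by rewrite inE /= in_itv /= lexx ler01. Qed.

Fact one_in_unit_interval (R : realType) : (1 : R) \in `[(0 : R), 1]%classic.
Proof. by rewrite inE /= in_itv /= lexx ler01. Qed.

Definition I0 (R : realType) : unit_interval R :=
  exist _ 0 (zero_in_unit_interval R).

Definition I1 (R : realType) : unit_interval R :=
  exist _ 1 (one_in_unit_interval R).

Definition open_cover (Z : topologicalType) (U : set (set Z)) :=
  (forall V, U V -> open V) /\ \bigcup_(V in U) V = [set: Z].

Definition preimage_cover (X Y : topologicalType) (f : X -> Y)
    (U : set (set Y)) : set (set X) :=
  [set f @^-1` V | V in U].

Section EquivariantTopology.
Variable G : topologicalGroupType.

Definition ginvariant (X : topologicalType) (aX : gaction G X) (S : set X) :=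
  forall g s, S s -> S (aX g s).

Definition gmap (X Y : topologicalType) (aX : gaction G X) (aY : gaction G Y)
    (f : X -> Y) :=
  continuous f /\ forall g x, f (aX g x) = aY g (f x).

Section InvariantSubspace.
Variables (X : topologicalType) (aX : gaction G X) (A : set X).
Hypothesis invA : ginvariant aX A.

Definition gact_sub (g : G) (a : A) : A :=
  exist _ (aX g (set_val a)) (mem_set (invA g (set_valP a))).

Lemma gact_sub1 a : gact_sub 1%g a = a.
Proof. by apply: val_inj; rewrite /= gact1. Qed.

Lemma gact_subM g h a : gact_sub (g * h)%g a = gact_sub g (gact_sub h a).
Proof. by apply: val_inj; rewrite /= gactM. Qed.

Lemma gact_sub_continuous : continuous (fun p : G * A => gact_sub p.1 p.2).
Proof.
move=> [g a] U [_ [[W oW <-] Wga] WU].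
have : nbhs (aX g (set_val a)) W by apply: open_nbhs_nbhs.
move=> /(@gact_continuous _ _ aX (g, set_val a)) [[P Q] /= [gP aQ] PQW].
exists (P, set_val @^-1` Q) => /=.
  by split=> //; exact: (@initial_continuous A X set_val).
by move=> [h b] /= [Ph Qb]; apply/WU/(PQW (h, set_val b)).
Qed.

Definition gaction_sub : gaction G A :=
  GAction gact_sub1 gact_subM gact_sub_continuous.

End InvariantSubspace.

Section Homotopy.
Variable R : realType.
Local Notation I := (unit_interval R).

Section Cylinder.
Variables (X : topologicalType) (aX : gaction G X).

Definition gact_cyl (g : G) (p : X * I) : X * I := (aX g p.1, p.2).

Lemma gact_cyl1 p : gact_cyl 1%g p = p.
Proof. by case: p => x t; rewrite /gact_cyl gact1. Qed.

Lemma gact_cylM g h p : gact_cyl (g * h)%g p = gact_cyl g (gact_cyl h p).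
Proof. by rewrite /gact_cyl gactM. Qed.

Lemma gact_cyl_continuous :
  continuous (fun p : G * (X * I)%type => gact_cyl p.1 p.2).
Proof.
move=> [g [x t]] U [[V W] /= [Vgx Wt] VWU].
have [[P Q] /= [Pg Qx] PQV] := @gact_continuous _ _ aX (g, x) V Vgx.
exists (P, Q `*` W) => /=; first by split=> //; exists (Q, W).
move=> [h [y s]] /= [Ph [Qy Ws]].
by apply: VWU; split=> //=; exact: (PQV (h, y)).
Qed.

Definition gaction_cyl : gaction G (X * I)%type :=
  GAction gact_cyl1 gact_cylM gact_cyl_continuous.

End Cylinder.

Variables (X Y : topologicalType) (aX : gaction G X) (aY : gaction G Y).

Definition ghomotopy (F : X * I -> Y) := gmap (gaction_cyl aX) aY F.

Definition cover_ghomotopy (U : set (set Y)) (F : X * I -> Y) :=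
  ghomotopy F /\
  forall x, exists2 V, U V & forall t, V (F (x, t)).

Definition cover_ghomotopic (U : set (set Y)) (f0 f1 : X -> Y) :=
  exists F : X * I -> Y,
    [/\ cover_ghomotopy U F,
        forall x, F (x, I0 R) = f0 x &
        forall x, F (x, I1 R) = f1 x].

End Homotopy.

Definition ghomotopy_dense (R : realType) (X : topologicalType)
    (aX : gaction G X) (A : set X) :=
  exists F : X * unit_interval R -> X,
    [/\ ghomotopy aX aX F,
        forall x, F (x, I0 R) = x &
        forall (t : unit_interval R) x, 0 < set_val t -> A (F (x, t))].

Definition fine_ghomotopy_equivalence (R : realType) (X Y : topologicalType)
    (aX : gaction G X) (aY : gaction G Y) (f : X -> Y) :=
  gmap aX aY f /\
  forall U : set (set Y), open_cover U ->
    exists phi : Y -> X,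
      [/\ gmap aY aX phi,
          cover_ghomotopic R aX aX (preimage_cover f U) (phi \o f) id &
          cover_ghomotopic R aY aY U (f \o phi) id].

End EquivariantTopology.

(* Main.v *)
(* Forward: given a deformation F of X into A and a cover U, the time up to
   which the track of x stays in one member of U is bounded below by a
   continuous positive function; its minimum over orbits (G is compact) is an
   invariant function e, and x |-> F (x, e x) is the required map.
   Backward: choose homotopy inverses phi_n : X -> A of the inclusion, with
   homotopies H_n : phi_n ~ id in X and K_n : phi_n ~ id in A, so fine that the
   tracks of H_n, K_n and phi_(n-1) o H_n have diameter < 1/(n+1). Then
   phi_n ~ phi_n o phi_(n+1) ~ phi_(n+1) inside A, through phi_n o H_(n+1) and
   K_n o phi_(n+1); concatenating these on the intervals [1/(k+1), 1/k] gives a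
   deformation converging to the identity at time 0. *)
Require Import Defs.
From mathcomp Require Import all_boot all_order all_algebra.
From mathcomp Require Import all_classical all_reals topology.
From mathcomp Require Import normedtype derive lra.
Set Implicit Arguments.
Unset Strict Implicit.
Unset Printing Implicit Defensive.
Import Order.TTheory GRing.Theory Num.Theory.
Import numFieldTopology.Exports numFieldNormedType.Exports.
Local Open Scope classical_set_scope.
Local Open Scope ring_scope.

Lemma continuous_pair (X Y Z : topologicalType) (f : X -> Y) (g : X -> Z) x :
  {for x, continuous f} -> {for x, continuous g} ->
  {for x, continuous (fun x => (f x, g x))}.
Proof. by move=> cf cg; apply: cvg_pair; [exact: cf|exact: cg]. Qed.

(** * Clamping real numbers to the unit interval *)

Section ClampI.
Variable R : realType.

Fact clampI_subproof (u : R) :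
  Num.max 0 (Num.min u 1) \in `[(0 : R), 1]%classic.
Proof.
by rewrite inE /= in_itv /= le_max lexx /= ge_max ler01 ge_min lexx orbT.
Qed.

(** Being total, the clamp lets time parameters be written as real formulas without membership
    proofs, with homotopies frozen outside [0,1]. *)
Definition clampI (u : R) : unit_interval R :=
  exist _ (Num.max 0 (Num.min u 1)) (clampI_subproof u).

Lemma clampI_continuous : continuous clampI.
Proof.
apply: continuous_comp_initial => u.
apply: (@continuous_max R R (fun=> 0) (fun v => Num.min v 1)).
  exact: cst_continuous.
by apply: (@continuous_min R R id (fun=> 1)) => //; exact: cst_continuous.
Qed.

Lemma clampI_le0 u : u <= 0 -> clampI u = I0 R.
Proof.
move=> u0; apply: val_inj => /=.
by rewrite min_l ?(le_trans u0)// max_l.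
Qed.

Lemma clampI_ge1 u : 1 <= u -> clampI u = I1 R.
Proof. by move=> u1; apply: val_inj; rewrite /= min_r// max_r. Qed.

Lemma val_clampI u : 0 <= u <= 1 -> set_val (clampI u) = u.
Proof. by move=> /andP[u0 u1]; rewrite /set_val /= min_l// max_r. Qed.

Lemma unit_interval_bounds (t : unit_interval R) : 0 <= set_val t <= 1.
Proof. by have := set_valP t; rewrite /= in_itv. Qed.

Lemma unit_interval_val_continuous :
  continuous (set_val : unit_interval R -> R).
Proof. exact: initial_continuous. Qed.

End ClampI.

(** * Metrizing distances and continuous radii *)

Section MetrizingDistance.
Variables (R : realType) (X : topologicalType).

Definition metrizes (d : X -> X -> R) :=
  [/\ forall x y, d x y = 0 <-> x = y,
      forall x y, d x y = d y x,
      forall x y z, d x z <= d x y + d y z &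
      forall x : X, nbhs x = nbhs_ball_ (fun x e => [set y | d x y < e]) x].

Variable d : X -> X -> R.
Hypothesis md : metrizes d.

Lemma dist_refl x : d x x = 0.
Proof. by have [d0 _ _ _] := md; apply/d0. Qed.

Lemma dist_sym x y : d x y = d y x.
Proof. by have [_ ds _ _] := md. Qed.

Lemma dist_triangle x y z : d x z <= d x y + d y z.
Proof. by have [_ _ dt _] := md. Qed.

Lemma dist_ge0 x y : 0 <= d x y.
Proof.
have := dist_triangle x y x; rewrite dist_refl (dist_sym y x).
by move=> ?; lra.
Qed.

Lemma nbhs_distP x (V : set X) :
  nbhs x V <-> exists2 e, 0 < e & forall y, d x y < e -> V y.
Proof. by have [_ _ _ ->] := md. Qed.

Lemma nbhs_dist x e : 0 < e -> \forall y \near x, d x y < e.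
Proof. by move=> e0; apply/nbhs_distP; exists e. Qed.

Lemma lipschitz1_continuous (f : X -> R) :
  (forall x y, f x <= f y + d x y) -> continuous f.
Proof.
move=> fl x; apply/cvgrPdist_lt => e e0; near=> y.
have xy : d x y < e by near: y; exact: nbhs_dist.
have := fl x y; have := fl y x; rewrite (dist_sym y x) ltr_norml => ? ?.
by apply/andP; split; lra.
Unshelve. all: by end_near. Qed.

(* The radius at [x] is the distance from [(x, 0)] to the set of pairs that
   violate [W], cut off at 1. *)
Lemma continuous_radius (W : X -> R -> Prop) :
  (forall x, exists2 e, 0 < e &
     forall y s, d x y < e -> 0 <= s < e -> W y s) ->
  exists f : X -> R,
    [/\ continuous f, forall x, 0 < f x <= 1 &
        forall x s, 0 <= s < f x -> W x s].
Proof.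
move=> locW.
pose E x := [set r | r = 1 \/
  exists y s, [/\ 0 <= s, ~ W y s & r = d x y + s]].
have E1 x : E x 1 by left.
have E0 x : lbound (E x) 0.
  by move=> r [->//|[y [s [s0 _ ->]]]]; rewrite addr_ge0// dist_ge0.
have hE x : has_inf (E x) by split; [exists 1|exists 0].
have infE x r : E x r -> inf (E x) <= r by apply: ge_inf; case: (hE x).
exists (fun x => inf (E x)); split.
- apply: lipschitz1_continuous => x z.
  rewrite -lerBlDr; apply: lb_le_inf; first by exists 1.
  move=> r [->|[y [s [s0 nW ->]]]]; rewrite lerBlDr.
    by rewrite (le_trans (infE _ _ (E1 x)))// lerDl dist_ge0.
  apply: (@le_trans _ _ (d x y + s)).
    by apply: infE; right; exists y, s.
  by have := dist_triangle x z y; move=> ?; lra.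
- move=> x; rewrite (infE _ _ (E1 x)) andbT.
  have [e e0 We] := locW x.
  apply: (@lt_le_trans _ _ (Num.min 1 e)); first by rewrite lt_min ltr01.
  apply: lb_le_inf; first by exists 1.
  move=> r [->|[y [s [s0 nW ->]]]]; first by rewrite ge_min lexx.
  rewrite ge_min; apply/orP; right; rewrite leNgt; apply/negP => ltdse.
  have := dist_ge0 x y => ?; apply: nW; apply: We; first by lra.
  by rewrite s0 /=; lra.
- move=> x s /andP[s0 sf]; apply: contrapT => nW.
  suff : inf (E x) <= s by rewrite leNgt sf.
  by apply: infE; right; exists x, s; rewrite dist_refl add0r.
Qed.

End MetrizingDistance.

(** * From a deformation into [A] to a fine equivalence *)

Section ForwardDirection.
Variables (R : realType) (G : topologicalGroupType).
Hypothesis compactG : compact [set: G].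
Variables (X : topologicalType) (aX : gaction G X).

(** The minimum of [f] over each orbit is attained because [G] is compact. The minimizer [h x] need
    not vary continuously with [x]; only the minimum value does. *)
Lemma orbit_min_continuous (f : X -> R) : continuous f ->
  exists m : X -> R,
    [/\ continuous m, forall g x, m (aX g x) = m x,
        forall x, exists g, m x = f (aX g x) & forall x, m x <= f x].
Proof.
move=> cf.
have cfa : continuous (fun p : G * X => f (aX p.1 p.2)).
  by move=> p; apply: continuous_comp; [exact: gact_continuous|exact: cf].
have /choice[h hmin] x : exists g, forall k, f (aX g x) <= f (aX k x).
  have G0 : [set: G] !=set0 by exists 1%g.
  have [|g _ gmin] := @compact_EVT_min G R (fun g => f (aX g x)) _ G0 compactG.
    apply: continuous_subspaceT => g.
    apply: (@continuous_comp _ _ _ (fun g => (g, x))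
      (fun p : G * X => f (aX p.1 p.2))); last exact: cfa.
    by apply: continuous_pair; [exact: cvg_id|exact: cvg_cst].
  by exists g => k; apply: gmin; rewrite in_setT.
exists (fun x => f (aX (h x) x)); split.
- move=> x; apply/cvgrPdist_lt => e e0.
  (* Upper semicontinuity: the minimizer for [x], kept fixed, bounds the minimum at [y] from
     above. *)
  have up : \forall y \near x, f (aX (h x) y) < f (aX (h x) x) + e.
    have : \forall y \near x, `|f (aX (h x) x) - f (aX (h x) y)| < e.
      have /cvgrPdist_lt : (fun y => f (aX (h x) y)) @ x --> f (aX (h x) x).
        apply: (@continuous_comp _ _ _ (fun y => (h x, y))
          (fun p : G * X => f (aX p.1 p.2))); last exact: cfa.
        by apply: continuous_pair; [exact: cvg_cst|exact: cvg_id].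
      exact.
    by apply: filterS => y; rewrite ltr_norml => /andP[? ?]; lra.
  (* Lower semicontinuity: by compactness of [G], one neighbourhood of [x] serves all [k] at once
     (tube lemma). *)
  have lo : \forall y \near x, forall k, f (aX (h x) x) - e < f (aX k y).
    have nc : near_covering [set: G] by apply/compact_near_coveringP.
    have ncx := nc X (nbhs x) (fun y k => f (aX (h x) x) - e < f (aX k y)) _.
    have {}ncx := ncx (nbhs_filter x).
    apply: filterS (ncx _) => [y yP k|k _]; first exact: yP.
    have /cvgrPdist_lt/(_ e e0) := cfa (k, x).
    apply: filterS => -[k' y] /=; rewrite ltr_norml => /andP[_].
    by have := hmin x k => ? ?; lra.
  near=> y; rewrite ltr_norml.
  have u : f (aX (h x) y) < f (aX (h x) x) + e by near: y.
  have l : f (aX (h x) x) - e < f (aX (h y) y).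
    by have : forall k, f (aX (h x) x) - e < f (aX k y) by near: y.
  by have := hmin y (h x) => ?; apply/andP; split; lra.
- move=> g x; apply/eqP; rewrite eq_le; apply/andP; split.
    have := hmin (aX g x) (h x * g^-1)%g.
    by rewrite -[in X in _ <= X]gactM -mulgA mulVg mulg1.
  by have := hmin x (h (aX g x) * g)%g; rewrite gactM.
- by move=> x; exists (h x).
- by move=> x; have := hmin x 1%g; rewrite gact1.
Unshelve. all: by end_near. Qed.

(** Continuity of [F] at time 0 gives the property [W] locally uniformly, so [continuous_radius]
    applies; the orbit minimum makes the radius invariant. *)
Lemma invariant_track_radius (d : X -> X -> R)
    (F : X * unit_interval R -> X) (U : set (set X)) :
  metrizes d -> continuous F -> (forall x, F (x, I0 R) = x) ->
  open_cover U ->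
  exists e : X -> R,
    [/\ continuous e, forall g x, e (aX g x) = e x, forall x, 0 < e x <= 1 &
        forall x, exists2 V, U V &
          forall s, 0 <= s <= e x -> V (F (x, clampI s))].
Proof.
move=> md cF F0 [oU cU].
pose W x s := exists2 V, U V &
  forall r, 0 <= r <= s -> V (F (x, clampI r)).
have [|e0 [ce0 e01 e0W]] := @continuous_radius R X d md W.
  move=> x.
  have [V UV Vx] : (\bigcup_(V in U) V) x by rewrite cU.
  have cFc : continuous (fun p : X * R => F (p.1, clampI p.2)).
    move=> p; apply: (@continuous_comp _ _ _
      (fun p : X * R => (p.1, clampI p.2)) F); last exact: cF.
    apply: continuous_pair; first exact: cvg_fst.
    by apply: continuous_comp; [exact: cvg_snd|exact: clampI_continuous].
  have : nbhs (x, 0 : R) [set p : X * R | V (F (p.1, clampI p.2))].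
    apply: cFc; rewrite /= clampI_le0// F0.
    by apply: open_nbhs_nbhs; split => //; exact: oU.
  move=> [[P Q] /= [/(nbhs_distP md)[e1 e10 Pe1] /nbhs_ballP[e2 e20 Qe2]] PQV].
  exists (Num.min e1 e2); first by rewrite lt_min e10.
  move=> y s; rewrite !lt_min => /andP[xy _] /and3P[s0 _ se2].
  exists V => // r /andP[r0 rs]; apply: (PQV (y, r)); split; first exact: Pe1.
  apply: Qe2; rewrite /ball /= sub0r normrN ger0_norm//.
  exact: le_lt_trans rs se2.
have [m [cm minv matt mle]] := orbit_min_continuous ce0.
(* Halving admits the endpoint [s = e x], since [continuous_radius] only covers times strictly below
   the radius. *)
exists (fun x => m x / 2); split => [x|g x|x|x].
- by apply: cvgM; [exact: cm|exact: cvg_cst].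
- by rewrite minv.
- by have [g ->] := matt x; have := e01 (aX g x) => /andP[? ?]; lra.
- apply: e0W; have := mle x; have [g ->] := matt x.
  by have := e01 (aX g x) => /andP[? ?] ?; lra.
Qed.

Lemma fine_of_dense (A : set X) (invA : ginvariant aX A) :
  metrizable R X -> ghomotopy_dense R aX A ->
  fine_ghomotopy_equivalence R (gaction_sub invA) aX (set_val : A -> X).
Proof.
move=> [d md] [F [[cF eF] F0 FA]].
have cval : continuous (set_val : A -> X) by exact: initial_continuous.
split; first by split.
move=> U oU.
have [e [ce einv e01 eU]] := invariant_track_radius md cF F0 oU.
(* The track of [x] is run backwards from time [e x] to time 0, hence ends at the identity. The same
   [H] serves on [X] and, restricted, on [A]. *)
pose H (p : X * unit_interval R) := F (p.1, clampI ((1 - set_val p.2) * e p.1)).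
have cH : continuous H.
  move=> p; apply: (@continuous_comp _ _ _
    (fun p : X * unit_interval R =>
       (p.1, clampI ((1 - set_val p.2) * e p.1))) F); last exact: cF.
  apply: continuous_pair; first exact: cvg_fst.
  apply: (@continuous_comp _ _ _
    (fun p : X * unit_interval R => (1 - set_val p.2) * e p.1) (@clampI R)).
    apply: cvgM.
      apply: cvgB; first exact: cvg_cst.
      by apply: continuous_comp;
        [exact: cvg_snd|exact: unit_interval_val_continuous].
    by apply: continuous_comp; [exact: cvg_fst|exact: ce].
  exact: clampI_continuous.
have eH g x t : H (aX g x, t) = aX g (H (x, t)).
  by rewrite /H /= einv -eF.
have rng x (t : unit_interval R) : 0 <= (1 - set_val t) * e x <= e x.
  have /andP[t0 t1] := unit_interval_bounds t; have /andP[ex0 _] := e01 x.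
  by apply/andP; split; nra.
have HU x : exists2 V, U V & forall t, V (H (x, t)).
  have [V UV VF] := eU x; exists V => // t; exact: VF.
have H1 x : H (x, I1 R) = x by rewrite /H /= subrr mul0r clampI_le0.
(* Before [t = 1] the time fed to [F] is positive; at [t = 1] the point is [x] itself. *)
have HA x t : A x \/ set_val t < 1 -> A (H (x, t)).
  have [t1 _|t1 [Ax|//]] := ltP (set_val t) 1.
    apply: FA; have /andP[ex0 ex1] := e01 x; have /andP[? ?] := rng x t.
    rewrite val_clampI; last by apply/andP; split => //; lra.
    by rewrite mulr_gt0// subr_gt0.
  suff -> : t = I1 R by rewrite H1.
  apply: val_inj; apply/eqP; rewrite eq_le t1 andbT.
  by have /andP[] := unit_interval_bounds t.
have HA0 x : A (H (x, I0 R)) by apply: HA; right; rewrite /= ltr01.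
pose phi x : A := exist _ (H (x, I0 R)) (mem_set (HA0 x)).
have HAA (p : A * unit_interval R) : A (H (set_val p.1, p.2)).
  by apply: HA; left; exact: set_valP.
pose K (p : A * unit_interval R) : A :=
  exist _ (H (set_val p.1, p.2)) (mem_set (HAA p)).
exists phi; split.
- split.
    apply: continuous_comp_initial => x.
    apply: (@continuous_comp _ _ _ (fun x => (x, I0 R)) H); last exact: cH.
    by apply: continuous_pair; [exact: cvg_id|exact: cvg_cst].
  by move=> g x; apply: val_inj => /=; rewrite eH.
- exists K; split.
  + split.
      split; last by move=> g [a t]; apply: val_inj => /=; rewrite -eH.
      apply: continuous_comp_initial => p.
      apply: (@continuous_comp _ _ _
        (fun p : A * unit_interval R => (set_val p.1, p.2)) H); last exact: cH.
      apply: continuous_pair; last exact: cvg_snd.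
      by apply: continuous_comp; [exact: cvg_fst|exact: cval].
    move=> a; have [V UV HV] := HU (set_val a).
    by exists (set_val @^-1` V); [exists V|move=> t; exact: HV].
  + by move=> a; apply: val_inj.
  + by move=> a; apply: val_inj; rewrite /= H1.
- exists H; split=> //; split=> //; split=> // g [x t]; exact: eH.
Qed.

End ForwardDirection.

(** * Infinite concatenation of homotopies accumulating at time 0 *)

Section Concatenation.
Variables (R : realType) (X : topologicalType) (d : X -> X -> R).
Hypothesis md : metrizes d.
Variable gamma : nat -> X * unit_interval R -> X.
Hypothesis gamma_continuous : forall k, continuous (gamma k).
Hypothesis gamma_match :
  forall k x, gamma k (x, I1 R) = gamma k.+1 (x, I0 R).
Hypothesis gamma_small : forall e : R, 0 < e ->
  exists N, forall k, (N <= k)%N -> forall x t, d x (gamma k (x, t)) < e.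

Definition leg (t : unit_interval R) : nat := Num.truncn (set_val t)^-1.

Definition leg_path k (p : X * unit_interval R) : X :=
  gamma k (p.1, clampI ((set_val p.2)^-1 - k%:R)).

(* On [1/(k+1), 1/k] the concatenation runs through [gamma k] backwards, so
   that [gamma k] for large [k] is seen near time 0. *)
Definition concatenation (p : X * unit_interval R) : X :=
  if set_val p.2 == 0 then p.1 else leg_path (leg p.2) p.

Lemma concatenation_small (e : R) : 0 < e ->
  exists2 c, 0 < c &
    forall x t, set_val t < c -> d x (concatenation (x, t)) < e.
Proof.
move=> e0; have [N NP] := gamma_small e0.
(* If 0 < t < 1/(N+1) then 1/t > N+1, so the leg has index at least [N]; the successor keeps the
   constant positive when [N] is 0. *)
exists N.+1%:R^-1; first by rewrite invr_gt0.
move=> x t tN; rewrite /concatenation /=.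
have [_|t0] := eqVneq (set_val t) 0; first by rewrite (dist_refl md).
apply: NP; have /andP[t_ge0 _] := unit_interval_bounds t.
have tp : 0 < set_val t by rewrite lt_neqAle eq_sym t0.
rewrite truncn_ge_nat; last by rewrite invr_ge0.
apply: (@le_trans _ _ N.+1%:R); first by rewrite ler_nat.
by rewrite -[leLHS]invrK lef_pV2 ?posrE ?invr_gt0// ltW.
Qed.

Lemma leg_path_continuous k x (t : unit_interval R) :
  0 < set_val t -> {for (x, t), continuous (leg_path k)}.
Proof.
move=> t0; apply: (@continuous_comp _ _ _ (fun p : X * unit_interval R =>
  (p.1, clampI ((set_val p.2)^-1 - k%:R))) (gamma k));
  last exact: gamma_continuous.
apply: continuous_pair; first exact: cvg_fst.
apply: (@continuous_comp _ _ _ (fun p : X * unit_interval R =>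
  (set_val p.2)^-1 - k%:R) (@clampI R)); last exact: clampI_continuous.
apply: cvgB; last exact: cvg_cst.
apply: cvgV; first by rewrite gt_eqF.
by apply: continuous_comp; [exact: cvg_snd|exact: unit_interval_val_continuous].
Qed.

Lemma concatenation_continuous : continuous concatenation.
Proof.
move=> [x t]; have [t0|t0] := eqVneq (set_val t) 0.
  rewrite /continuous_at.
  have -> : concatenation (x, t) = x by rewrite /concatenation /= t0 eqxx.
  move=> V /(nbhs_distP md)[e e0 eV].
  have e2 : 0 < e / 2 by rewrite divr_gt0.
  have [c c0 cP] := concatenation_small e2.
  suff : \forall p \near (x, t), d x (concatenation p) < e.
    by move=> small; apply: filterS small => p; exact: eV.
  near=> p.
  have := dist_triangle md x p.1 (concatenation p).
  have : d p.1 (concatenation (p.1, p.2)) < e / 2.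
    apply: cP.
    near: p.
    have cv :
        (fun p : X * unit_interval R => set_val p.2) @ (x, t) --> set_val t.
      apply: continuous_comp; [exact: cvg_snd|].
      exact: unit_interval_val_continuous.
    by apply: (cv [set r | r < c]); rewrite t0; exact: lt_nbhsl.
  have : d x p.1 < e / 2.
    near: p.
    have cv : (fun p : X * unit_interval R => p.1) @ (x, t) --> x.
      exact: cvg_fst.
    exact: (cv [set y | d x y < e / 2] (nbhs_dist md x e2)).
  by rewrite -surjective_pairing => ? ? ?; lra.
have tp : 0 < set_val t.
  by rewrite lt_neqAle eq_sym t0; have /andP[] := unit_interval_bounds t.
have sp0 : 0 < (set_val t)^-1 by rewrite invr_gt0.
have cs : {for (x, t), continuous
    (fun p : X * unit_interval R => (set_val p.2)^-1)}.
  apply: (@continuous_comp _ _ _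
    (fun p : X * unit_interval R => set_val p.2) GRing.inv).
    by apply: continuous_comp;
      [exact: cvg_snd|exact: unit_interval_val_continuous].
  exact: inv_continuous.
(* As t <= 1, the leg index is at least 1, so a leg [k] precedes it and can be glued at the
   junction. *)
have [k legt] : exists k, leg t = k.+1.
  exists (leg t).-1; rewrite prednK// /leg truncn_ge_nat; last exact: ltW.
  by rewrite invf_ge1//; have /andP[] := unit_interval_bounds t.
have /andP[ks sk] : k.+1%:R <= (set_val t)^-1 < k.+2%:R.
  by rewrite -legt; apply: truncn_itv; exact: ltW.
have near_itv : \forall p \near (x, t), k%:R < (set_val p.2)^-1 < k.+2%:R.
  have gt_k : \forall p \near (x, t), k%:R < (set_val p.2)^-1.
    apply: (cs [set r | k%:R < r]); apply: lt_nbhsr => /=.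
    by apply: lt_le_trans ks; rewrite ltr_nat.
  have lt_k : \forall p \near (x, t), (set_val p.2)^-1 < k.+2%:R.
    by apply: (cs [set r | r < k.+2%:R]); exact: lt_nbhsl.
  by apply: filterS2 gt_k lt_k => p -> ->.
have catE p n : n%:R <= (set_val p.2)^-1 < n.+1%:R -> 0 < (set_val p.2)^-1 ->
    concatenation p = leg_path n p.
  move=> np p0; rewrite /concatenation /leg (truncn_def np).
  by rewrite gt_eqF// -invr_gt0.
move=> V; rewrite (catE _ k.+1) ?ks// => Vk.
suff : \forall p \near (x, t), V (concatenation p) by [].
have near_Sk := leg_path_continuous tp Vk.
(* If 1/t > k+1, all nearby times lie on leg [k.+1]. If 1/t = k+1, nearby times may lie on leg [k]
   or [k.+1], whose formulas agree at [t] by [gamma_match]. *)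
have [sk'|sk'] := ltP k.+1%:R (set_val t)^-1.
  have near_gt : \forall p \near (x, t), k.+1%:R < (set_val p.2)^-1.
    by apply: (cs [set r | k.+1%:R < r]); exact: lt_nbhsr.
  near=> p.
  have pk : k.+1%:R < (set_val p.2)^-1 by near: p; exact: near_gt.
  rewrite (catE _ k.+1); first by near: p; exact: near_Sk.
    rewrite ltW//=.
    by have /andP[] : k%:R < (set_val p.2)^-1 < k.+2%:R by near: p.
  exact: le_lt_trans pk.
have seq : (set_val t)^-1 = k.+1%:R by apply/eqP; rewrite eq_le sk' ks.
have legE : leg_path k.+1 (x, t) = leg_path k (x, t).
  rewrite /leg_path /= seq clampI_le0 ?subrr// -gamma_match clampI_ge1//.
  by rewrite -natrB// subSnn.
have near_k : \forall p \near (x, t), V (leg_path k p).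
  by apply: leg_path_continuous => //; rewrite -legE.
near=> p.
have /andP[kp pk] : k%:R < (set_val p.2)^-1 < k.+2%:R by near: p.
have p0 : 0 < (set_val p.2)^-1 by exact: le_lt_trans kp.
have [le_kp|lt_pk] := leP k.+1%:R (set_val p.2)^-1.
  by rewrite (catE _ k.+1) ?le_kp ?pk//; near: p; exact: near_Sk.
by rewrite (catE _ k) ?ltW//; near: p; exact: near_k.
Unshelve. all: by end_near. Qed.

End Concatenation.

(** * From a fine equivalence to a deformation *)

Section BackwardDirection.
Variables (R : realType) (G : topologicalGroupType).
Variables (X : topologicalType) (aX : gaction G X).
Variables (A : set X) (invA : ginvariant aX A).
Local Notation I := (unit_interval R).
Local Notation aA := (gaction_sub invA).

(** The cover is left out of the record: its control is restated metrically in [finer], so that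
    inverses for different covers form one type and can be chosen in sequence. *)
Record approx_inverse := ApproxInverse {
  rphi : X -> A ;
  rH : X * I -> X ;
  rK : A * I -> A ;
  rphi_gmap : gmap aX aA rphi ;
  rH_ghomotopy : ghomotopy aX aX rH ;
  rK_ghomotopy : ghomotopy aA aA rK ;
  rH0 : forall x, rH (x, I0 R) = set_val (rphi x) ;
  rH1 : forall x, rH (x, I1 R) = x ;
  rK0 : forall a, rK (a, I0 R) = rphi (set_val a) ;
  rK1 : forall a, rK (a, I1 R) = a
}.

Variable d : X -> X -> R.
Hypothesis md : metrizes d.

Definition finer (e : R) (psi : X -> X) (r : approx_inverse) :=
  [/\ forall x s t, d (rH r (x, s)) (rH r (x, t)) < e,
      forall x s t, d (psi (rH r (x, s))) (psi (rH r (x, t))) < e &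
      forall a s t, d (set_val (rK r (a, s))) (set_val (rK r (a, t))) < e].

Hypothesis fineA :
  fine_ghomotopy_equivalence R aA aX (set_val : A -> X).

(** Fineness is applied to the cover by open sets on which points, and their images under [psi], are
    less than [e] apart; each track lies in one such set. *)
Lemma exists_finer (e : R) (psi : X -> X) : 0 < e -> continuous psi ->
  exists r, finer e psi r.
Proof.
move=> e0 cpsi; have [_ fA] := fineA.
pose U := [set V : set X | open V /\
  forall y z, V y -> V z -> d y z < e /\ d (psi y) (psi z) < e].
have /fA[phi] : open_cover U.
  split=> [V []//|]; apply/seteqP; split=> // x _.
  have e2 : 0 < e / 2 by rewrite divr_gt0.
  pose S := [set y | d x y < e / 2 /\ d (psi x) (psi y) < e / 2].
  have nS : nbhs x S.
    have nx := nbhs_dist md x e2.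
    have npsi := cpsi x _ (nbhs_dist md (psi x) e2).
    by apply: filterS2 nx npsi.
  exists (interior S) => //; split; first exact: open_interior.
  move=> y z /interior_subset[xy pxy] /interior_subset[xz pxz].
  have := dist_triangle md y x z; rewrite (dist_sym md y x).
  have := dist_triangle md (psi y) (psi x) (psi z).
  by rewrite (dist_sym md (psi y) (psi x)) => ? ?; split; lra.
move=> [gphi [K [[gK KU] K0 K1]] [H [[gH HU] H0 H1]]].
exists (ApproxInverse gphi gH gK H0 H1 K0 K1); split=> /= [x s t|x s t|a s t].
- by have [V [_ VU] HV] := HU x; case: (VU _ _ (HV s) (HV t)).
- by have [V [_ VU] HV] := HU x; case: (VU _ _ (HV s) (HV t)).
- by have [_ [V [_ VU] <-] KV] := KU a; case: (VU _ _ (KV s) (KV t)).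
Qed.

Definition rmap (r : approx_inverse) (x : X) : X := set_val (rphi r x).

Lemma rmap_continuous r : continuous (rmap r).
Proof.
move=> x; apply: continuous_comp; first exact: (rphi_gmap r).1.
exact: initial_continuous.
Qed.

Lemma finer_sequence : exists s : nat -> approx_inverse,
  forall n, finer n.+1%:R^-1 (if n is m.+1 then rmap (s m) else id) (s n).
Proof.
have e0 n : 0 < n.+1%:R^-1 :> R by rewrite invr_gt0.
have [r0 r0P] : exists r, finer 1%:R^-1 id r.
  by apply: (exists_finer (e0 0)) => x; exact: cvg_id.
(* Each choice depends on the previous inverse, through [psi], so the choice function takes the
   index together with that inverse. *)
have /choice[next nextP] (p : nat * approx_inverse) :
    exists r, finer p.1.+2%:R^-1 (rmap p.2) r.
  exact: exists_finer (e0 _) (@rmap_continuous p.2).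
exists (fix s n := if n is m.+1 then next (m, s m) else r0).
by case=> // n; exact: (nextP (n, _)).
Qed.

Lemma dense_of_fine : ghomotopy_dense R aX A.
Proof.
have [s sP] := finer_sequence.
have cval : continuous (set_val : A -> X) by exact: initial_continuous.
pose rev (t : I) : I := clampI (1 - set_val t).
(* With n = k/2 rounded down, the even leg goes from phi_n to phi_n o phi_(n+1) and the odd leg from
   there to phi_(n+1). Time is reversed on even legs because [rH] ends at the identity. *)
pose gamma k (p : X * I) : A :=
  if odd k then rK (s k./2) (rphi (s k./2.+1) p.1, p.2)
  else rphi (s k./2) (rH (s k./2.+1) (p.1, rev p.2)).
have crev : continuous rev.
  move=> t; apply: (@continuous_comp _ _ _ (fun t : I => 1 - set_val t)
    (@clampI R)); last exact: clampI_continuous.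
  apply: (@continuousB R R I (fun=> 1) set_val).
    exact: cst_continuous.
  exact: unit_interval_val_continuous.
have cgamma k : continuous (fun p => set_val (gamma k p)).
  move=> p; apply: (@continuous_comp _ _ _ (gamma k)); last exact: cval.
  rewrite /gamma; case: odd.
    apply: (@continuous_comp _ _ _ (fun p : X * I =>
      (rphi (s k./2.+1) p.1, p.2)) (rK (s k./2)));
      last exact: (rK_ghomotopy _).1.
    apply: continuous_pair; last exact: cvg_snd.
    by apply: continuous_comp; [exact: cvg_fst|exact: (rphi_gmap _).1].
  apply: (@continuous_comp _ _ _ (fun p : X * I =>
    rH (s k./2.+1) (p.1, rev p.2)) (rphi (s k./2)));
    last exact: (rphi_gmap _).1.
  apply: (@continuous_comp _ _ _ (fun p : X * I => (p.1, rev p.2))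
    (rH (s k./2.+1))); last exact: (rH_ghomotopy _).1.
  apply: continuous_pair; first exact: cvg_fst.
  by apply: continuous_comp; [exact: cvg_snd|exact: crev].
have egamma k g x t : gamma k (aX g x, t) = aA g (gamma k (x, t)).
  rewrite /gamma; case: odd; rewrite [fst _]/= [snd _]/=.
    rewrite (rphi_gmap _).2.
    exact: ((rK_ghomotopy (s k./2)).2 g (rphi (s k./2.+1) x, t)).
  rewrite -(rphi_gmap (s k./2)).2; congr (rphi _ _).
  exact: ((rH_ghomotopy (s k./2.+1)).2 g (x, rev t)).
have mgamma k x : gamma k (x, I1 R) = gamma k.+1 (x, I0 R).
  rewrite /gamma /= uphalf_half; case: odd => /=.
    by rewrite rK1 /rev subr0 clampI_ge1// rH1.
  by rewrite /rev subrr clampI_le0// rH0 rK0.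
have sgamma (e : R) : 0 < e -> exists N, forall k, (N <= k)%N ->
    forall x t, d x (set_val (gamma k (x, t))) < e.
  (* This gives 1/(N+1) < e/2; the index is doubled below because each n accounts for two legs. *)
  move=> e0; pose N := Num.truncn (e / 2)^-1.
  have e2 : 0 < e / 2 by rewrite divr_gt0.
  exists N.*2 => k Nk x t; set n := k./2.
  have Nn : (N <= n)%N by rewrite -(doubleK N) half_leq.
  have ne : n.+1%:R^-1 < e / 2.
    rewrite invf_plt ?posrE//.
    have /andP[_] := truncn_itv (ltW (etrans (invr_gt0 _) e2)).
    by move=> /lt_le_trans; apply; rewrite ler_nat.
  have nSn : n.+2%:R^-1 <= n.+1%:R^-1 :> R.
    by rewrite lef_pV2 ?posrE// ler_nat.
  have [Hn _ Kn] := sP n; have [HSn pSn _] := sP n.+1.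
  (* On odd legs the intermediate point is phi_(n+1)(x), the end of the [rK] track. On even legs it
     is phi_n(x), and the [psi] clause of [finer] for [s n.+1] bounds the track of phi_n o
     H_(n+1). *)
  rewrite /gamma -/n; case: odd => /=.
    set a := rphi _ x.
    apply: le_lt_trans (dist_triangle md x (set_val a) _) _.
    rewrite (splitr e); apply: ltrD; last first.
      by apply: lt_trans ne; have := Kn a (I1 R) t; rewrite rK1.
    apply: le_lt_trans ne; apply: le_trans nSn; apply: ltW.
    by have := HSn x (I1 R) (I0 R); rewrite rH1 rH0.
  apply: le_lt_trans (dist_triangle md x (rmap (s n) x) _) _.
  rewrite (splitr e); apply: ltrD.
    by apply: lt_trans ne; have := Hn x (I1 R) (I0 R); rewrite rH1 rH0.
  apply: le_lt_trans ne; apply: le_trans nSn; apply: ltW.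
  by have := pSn x (I1 R) (rev t); rewrite rH1.
exists (concatenation (fun k p => set_val (gamma k p))); split.
- split; first apply: (concatenation_continuous md cgamma _ sgamma).
    by move=> k x; rewrite mgamma.
  move=> g [x t]; rewrite /concatenation /leg_path /=.
  by case: eqP => // _; rewrite egamma.
- by move=> x; rewrite /concatenation /= eqxx.
- move=> t x t0; rewrite /concatenation /= gt_eqF//; exact: set_valP.
Qed.

End BackwardDirection.

Theorem theorem5p4 (R : realType) (G : topologicalGroupType)
    (compactG : compact [set: G]) (hausdorffG : hausdorff_space G)
    (X : topologicalType) (aX : gaction G X) (metrizableX : metrizable R X)
    (A : set X) (invA : ginvariant aX A) :
  ghomotopy_dense R aX A <->
  fine_ghomotopy_equivalence R (gaction_sub invA) aX (set_val : A -> X).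
Proof.
split; first exact: fine_of_dense.
by have [d md] := metrizableX; exact: (dense_of_fine md).
Qed.
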